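(* Let $\lambda\ge\kappa\ge\omega$ be cardinals and let $\mathcal{A}\subseteq[\lambda]^{\ge\kappa}$ be a $\kappa$-hereditarily essentially disjoint family. Then there is a function $c:\lambda\to\kappa$ such that $|I_c(A)|=\kappa$ for all $A\in\mathcal{A}$.
   Context: $[X]^{\ge\kappa}=\{A\subseteq X:|A|\ge\kappa\}$, $[X]^{\kappa}$ and $[X]^{<\kappa}$ are the sets of subsets of size $\kappa$, resp. $<\kappa$. A family $\mathcal{B}\subseteq[X]^{\kappa}$ is essentially disjoint iff for each $B\in\mathcal{B}$ there is $F(B)\in[B]^{<\kappa}$ such that the sets $B\setminus F(B)$, $B\in\mathcal{B}$, are pairwise disjoint. A family $\mathcal{A}$ is $\kappa$-hereditarily essentially disjoint iff for every function $H$ with domain $\mathcal{A}$ and $H(A)\in[A]^{\kappa}$ for all $A\in\mathcal{A}$, the family $\{H(A):A\in\mathcal{A}\}$ is essentially disjoint. For a function $f$ and set $A$, $I_f(A)=\{\xi\in\operatorname{ran}(f):|A\cap f^{-1}\{\xi\}|=1\}$. *)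

(* Defs.v *)
From mathcomp Require Import all_boot.
From mathcomp Require Import boolp classical_sets functions cardinality.

Set Implicit Arguments.
Unset Strict Implicit.
Unset Printing Implicit Defensive.

Local Open Scope classical_set_scope.
Local Open Scope card_scope.

(* A cardinal is represented by a type of that cardinality: [K] stands for
   kappa, and |X| is compared with kappa as [X] with [[set: K]]. *)

(* [X]^{>= kappa}, [X]^kappa and [X]^{< kappa} *)
Definition subsets_ge (K T : Type) (X : set T) : set (set T) :=
  [set A | A `<=` X /\ [set: K] #<= A].

Definition subsets_eq (K T : Type) (X : set T) : set (set T) :=
  [set A | A `<=` X /\ A #= [set: K]].

Definition subsets_lt (K T : Type) (X : set T) : set (set T) :=
  [set A | [/\ A `<=` X, A #<= [set: K] & A #!= [set: K]]].

(* Disjointness is that of the family indexed by BB: distinct members B, B' of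
   BB must have disjoint remainders. *)
Definition essentially_disjoint (K T : Type) (X : set T)
    (BB : set (set T)) : Prop :=
  BB `<=` subsets_eq K X /\
  exists F : set T -> set T,
    (forall B, BB B -> subsets_lt K B (F B)) /\
    trivIset BB (fun B => B `\` F B).

(* Only the values of H on AA matter; {H(A) : A in AA} is a set of sets, so
   equal values of H are identified. *)
Definition hereditarily_essentially_disjoint (K T : Type) (X : set T)
    (AA : set (set T)) : Prop :=
  forall H : set T -> set T,
    (forall A, AA A -> subsets_eq K A (H A)) ->
    essentially_disjoint K X (H @` AA).

(* I_f(A): the values of f taken exactly once on A *)
Definition unique_values (T U : Type) (f : T -> U) (A : set T) : set U :=
  [set xi | range f xi /\ A `&` f @^-1` [set xi] #= `I_1].

(* Main.v *)
(* If every member of the family has size kappa, then with F witnessing essential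
   disjointness it suffices to colour each A \ F(A) injectively. For larger
   members one first assigns a sort t(A) in omega to each A and a set of points
   H(A) to be coloured with colours of that sort, so that A meets the union of the
   H(B) with t(B) = t(A) in exactly kappa points; these traces have size kappa and
   the previous colouring works within each sort.

   Sorts are built by induction on the size of the family, cutting it into layers.
   For a set Q of points, at most |Q| members meet Q in kappa points; closing off
   under this, a set A of layer i meets the points Z_i used by the earlier layers
   in at most kappa points, while a point outside Z_i lies in at most one earlier
   set. Layer i therefore only uses points x outside Z_i, with sorts larger than
   that of the earlier set containing x: a set is disturbed neither by later
   layers nor, at more than kappa points, by earlier ones. *)

Require Import Defs.
From Stdlib Require Import Wellfounded.Inverse_Image.
From mathcomp Require Import all_boot.
From mathcomp Require Import boolp classical_sets functions cardinality wochoice.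

Local Open Scope classical_set_scope.
Local Open Scope card_scope.

(** * Cardinal arithmetic *)

(** Relations need no values chosen off [A], which would be impossible with [U] empty. *)
Lemma card_le_relP (T U : Type) (A : set T) (B : set U) :
  A #<= B <-> exists R : T -> U -> Prop,
    (forall x, A x -> exists2 y, B y & R x y) /\
    (forall x x' y, A x -> A x' -> R x y -> R x' y -> x = x').
Proof.
split=> [/card_leP[f]|[R [totR injR]]].
  have [/eqP A0|/set0P[a Aa]] := boolP (A == set0).
    by exists (fun _ _ => False); rewrite A0; split.
  exists (fun x y => exists xA : A x, y = set_val (f (SigSub (mem_set xA)))); split.
    by move=> x Ax; exists (set_val (f (SigSub (mem_set Ax)))); [exact: set_valP|exists Ax].
  move=> x x' y _ _ [Ax ->] [Ax' /val_inj].
  by move=> /(@inj _ _ _ f); rewrite !in_setT => /(_ isT isT) /(congr1 val).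
have [/eqP->|/set0P[a Aa]] := boolP (A == set0); first exact: card_ge0.
have [b _ _] := totR a Aa.
have /choice[f fP] : forall x, exists y, A x -> B y /\ R x y.
  move=> x; have [/totR[y By Rxy]|nAx] := pselect (A x); first by exists y.
  by exists b.
have fB : f @` A `<=` B by move=> _ [x Ax <-]; case: (fP x Ax).
apply: card_le_trans (subset_card_le fB).
have injf : {in A &, injective f}.
  move=> x y /set_mem Ax /set_mem Ay fxy; apply: (injR x y (f y)) => //.
    by rewrite -fxy; case: (fP x Ax).
  by case: (fP y Ay).
by have := inj_card_eq injf; rewrite card_eq_le => /andP[].
Qed.

Lemma card_le_rel {T U : Type} {A : set T} {B : set U} (R : T -> U -> Prop) :
  (forall x, A x -> exists2 y, B y & R x y) ->
  (forall x x' y, A x -> A x' -> R x y -> R x' y -> x = x') -> A #<= B.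
Proof. by move=> totR injR; apply/card_le_relP; exists R. Qed.

Lemma card_le_fun {T U : Type} {A : set T} {B : set U} (u : U) : A #<= B ->
  exists f : T -> U, (forall x, A x -> B (f x)) /\
    (forall x y, A x -> A y -> f x = f y -> x = y).
Proof.
move=> /card_le_relP[R [totR injR]].
have /choice[f fP] : forall x, exists y, A x -> B y /\ R x y.
  move=> x; have [/totR[y By Rxy]|nAx] := pselect (A x); first by exists y.
  by exists u.
exists f; split=> [x /fP[]//|x y Ax Ay fxy].
by apply: (injR x y (f x)) => //; [|rewrite fxy]; [have [] := fP x Ax|have [] := fP y Ay].
Qed.

Lemma card_le_subset {T U : Type} {A : set T} {B : set U} : A #<= B ->
  exists2 Z, Z `<=` B & Z #= A.
Proof.
move=> AB; have [/eqP->|/set0P[a Aa]] := boolP (A == set0).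
  by exists set0 => //; exact: card_eq00.
have [R [totR _]] := (card_le_relP _ _ _ _).1 AB; have [b _ _] := totR a Aa.
have [f [fB injf]] := card_le_fun b AB.
exists (f @` A); first by move=> _ [x /fB ? <-].
by apply: inj_card_eq => x y /set_mem Ax /set_mem Ay; exact: injf.
Qed.

(* A maximal set of choice functions that are pairwise distinct everywhere has
   a surjective projection onto some [X i], which then injects into all [X j]. *)
Lemma card_min {I : Type} {T : I -> Type} (X : forall i, set (T i)) (i0 : I) :
  exists i, forall j, X i #<= X j.
Proof.
pose good (Z : set (forall i, T i)) :=
  (forall f i, Z f -> X i (f i)) /\
  (forall f g i, Z f -> Z g -> f i = g i -> f = g).
have [F Fgood totF|Z [[ZX Zinj] Zmax]] := @Zorn_bigcup _ good.
  split=> [f i [Z /Fgood[ZX _]]|f g i [Z FZ Zf] [Z' FZ' Z'g]]; first exact: ZX.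
  have [ZZ'|Z'Z] := totF _ _ FZ FZ'.
    by have [_] := Fgood _ FZ'; apply=> //; exact: ZZ'.
  by have [_] := Fgood _ FZ; apply=> //; exact: Z'Z.
have [i Xi] : exists i, forall x, X i x -> exists2 f, Z f & f i = x.
  apply: contrapT => /forallNP noi.
  have fresh i : {x | X i x /\ forall f, Z f -> f i <> x}.
    apply: cid; have /existsNP[x /not_implyP[Xx noF]] := noi i.
    by exists x; split=> // f Zf fx; apply: noF; exists f.
  pose g i := sval (fresh i).
  have gP i : X i (g i) /\ forall f, Z f -> f i <> g i by exact: svalP (fresh i).
  apply: (Zmax (Z `|` [set g])).
    split; first by move=> f; left.
    by move=> Zsub; have [_ /(_ g (Zsub g (or_intror erefl)))] := gP i0.
  split=> [f i [/ZX//|->]|f h i]; first by have [] := gP i.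
  move=> [Zf|->] [Zh|->] //; first exact: Zinj.
    by have [_ /(_ f Zf)] := gP i.
  by have [_ /(_ h Zh) + /esym] := gP i.
exists i => j; apply: (card_le_rel (fun x y => exists f, [/\ Z f, f i = x & f j = y])).
  by move=> x /Xi[f Zf fx]; exists (f j); [exact: ZX|exists f].
by move=> x x' y _ _ [f [Zf <- <-]] [g [Zg <- /(Zinj _ _ _ Zg Zf)->]].
Qed.

(** This is [card_min] for two sets indexed by [bool]. *)
Lemma card_le_total {T U : Type} (A : set T) (B : set U) : A #<= B \/ B #<= A.
Proof.
pose TU (b : bool) : Type := if b then T else U.
pose X := bool_rect (fun b => set (TU b)) A B.
by have [[] /= le] := card_min X true; [left; exact: le false|right; exact: le true].
Qed.

Lemma card_leNle {T U : Type} {A : set T} {B : set U} : ~ (A #<= B) -> B #<= A.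
Proof. by have [] := card_le_total A B. Qed.

Lemma card_le_setX {T U T' U' : Type} {A : set T} {B : set U} {A' : set T'} {B' : set U'} :
  A #<= A' -> B #<= B' -> A `*` B #<= A' `*` B'.
Proof.
move=> /card_le_relP[R [totR injR]] /card_le_relP[S [totS injS]].
apply: (card_le_rel (fun x y => R x.1 y.1 /\ S x.2 y.2)).
  move=> [x1 x2] [/= /totR[y1 ? ?] /totS[y2 ? ?]]; by exists (y1, y2).
move=> [x1 x2] [x1' x2'] [y1 y2] [/= ? ?] [/= ? ?] [/= ? ?] [/= ? ?].
by congr pair; [apply: (injR _ _ y1)|apply: (injS _ _ y2)].
Qed.

Lemma nat_le_two {T : Type} {M : set T} : [set: nat] #<= M ->
  exists a b, [/\ M a, M b & a <> b].
Proof.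
move=> M_inf; have [R [totR injR]] := (card_le_relP _ _ _ _).1 M_inf.
have [a Ma R0] := totR 0 I; have [b Mb R1] := totR 1 I.
exists a, b; split=> // ab; rewrite ab in R0.
by have := injR 0 1 b I I R0 R1.
Qed.

(** A point is coded by an index and its code within that member. The square of [M] is bounded by
    hypothesis because the lemma serves to prove [card_setX_infinite]. *)
Lemma card_le_bigcup_setX {I T S : Type} {D : set I} {F : I -> set T} {M : set S} :
  M `*` M #<= M -> D #<= M -> (forall i, D i -> F i #<= M) ->
  \bigcup_(i in D) F i #<= M.
Proof.
move=> MM /card_le_relP[R [totR injR]] FM; apply: card_le_trans MM.
have /choice[Q QP] : forall i, exists Q : T -> S -> Prop, D i ->
    (forall x, F i x -> exists2 y, M y & Q x y) /\
    (forall x x' y, F i x -> F i x' -> Q x y -> Q x' y -> x = x').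
  move=> i; have [/FM/card_le_relP[Q QP]|nDi] := pselect (D i); first by exists Q.
  by exists (fun _ _ => True).
apply: (card_le_rel (fun x y => exists i, [/\ D i, F i x, R i y.1 & Q i x y.2])).
  move=> x [i Di Fx]; have [a Ma Ra] := totR i Di.
  have [totQ _] := QP i Di; have [b Mb Qb] := totQ x Fx.
  by exists (a, b) => //; exists i.
move=> x x' [a b] _ _ [i [Di Fx /= Ra Qb]] [i' [Di' Fx' /= Ra' Qb']].
have ii' := injR _ _ _ Di Di' Ra Ra'; subst i'.
by have [_ injQ] := QP i Di; exact: injQ Qb Qb'.
Qed.

Lemma card_le_setU_setX {T S : Type} {A B : set T} {M : set S} : [set: nat] #<= M ->
  M `*` M #<= M -> A #<= M -> B #<= M -> A `|` B #<= M.
Proof.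
move=> M_inf MM AM BM.
have [a [b [Ma Mb ab]]] := nat_le_two M_inf.
have -> : A `|` B = \bigcup_(i in [set: bool]) (if i then A else B).
  apply/seteqP; split=> [x [Ax|Bx]|x [[] _ ?]]; [by exists true|by exists false|by left|by right].
apply: card_le_bigcup_setX => // [|[]//].
apply: (card_le_rel (fun x y => y = if x then a else b)).
  by move=> [] _; [exists a|exists b].
by move=> [] [] y _ _ // -> // /esym.
Qed.

(** Hessenberg's theorem: Zorn's lemma gives a maximal injection of the square of some [B] into [B].
    If [B] were smaller than [M], a copy [C] of [B] in the complement would absorb all new pairs. *)
Lemma card_setX_infinite {T : Type} {M : set T} : [set: nat] #<= M -> M `*` M #<= M.
Proof.
move=> M_inf.
(* The diagonal recovers [B] from the graph. The empty graph is allowed so that the empty chain has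
   a bound. *)
pose dom (G : set ((T * T) * T)) := [set x | exists y, G ((x, x), y)].
pose good G := [/\ dom G `<=` M, G = set0 \/ [set: nat] #<= dom G,
  forall z, (dom G `*` dom G) z -> exists2 y, dom G y & G (z, y),
  forall z y, G (z, y) -> (dom G `*` dom G) z /\ dom G y &
  forall z z' y, G (z, y) -> G (z', y) -> z = z'].
have domS G G' : G `<=` G' -> dom G `<=` dom G' by move=> GG' x [y /GG']; exists y.
have [F Fgood totF|G [[GM G0 Gtot Gdom Ginj] Gmax]] := @Zorn_bigcup _ good.
  set V := \bigcup_(X in F) X.
  have FV G : F G -> G `<=` V by move=> FG z Gz; exists G.
  split.
  - by move=> x [y [G FG Gxy]]; have [GM _ _ _ _] := Fgood _ FG; apply: GM; exists y.
  - have [V0|/existsNP[G /not_implyP[FG G0]]] := pselect (forall G, F G -> G = set0).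
      by left; apply/seteqP; split=> // z [G /V0->].
    right; have [_ [//|G_inf] _ _ _] := Fgood _ FG.
    by apply: card_le_trans G_inf _; apply: subset_card_le; apply: domS; exact: FV.
  - move=> [x x'] [/= [y [G FG Gxy]] [y' [G' FG' Gxy']]].
    have [H [FH Hx Hx']] : exists H, [/\ F H, dom H x & dom H x'].
      have [GG'|G'G] := totF _ _ FG FG'.
        by exists G'; split=> //; [exists y; exact: GG'|exists y'].
      by exists G; split=> //; [exists y|exists y'; exact: G'G].
    have [_ _ Htot _ _] := Fgood _ FH.
    have [//|w Hw Hxw] := Htot (x, x').
    by exists w; [exact: domS (FV _ FH) _ Hw|exists H].
  - move=> z y [G FG Gzy]; have [_ _ _ + _] := Fgood _ FG => /(_ _ _ Gzy)[[? ?] ?].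
    by split; [split|]; apply: (domS _ _ (FV _ FG)).
  - move=> z z' y [G FG Gzy] [G' FG' Gzy'].
    have [GG'|G'G] := totF _ _ FG FG'.
      by have [_ _ _ _] := Fgood _ FG'; apply; [exact: GG' Gzy|].
    by have [_ _ _ _] := Fgood _ FG; apply; [exact: Gzy|exact: G'G].
set B := dom G in GM G0 Gtot Gdom.
have BB : B `*` B #<= B.
  apply: (card_le_rel (fun z y => G (z, y))) => [z /Gtot[y]|z z' y _ _]; last exact: Ginj.
  by exists y.
have ext C : C `<=` M -> C `&` B = set0 -> [set: nat] #<= C ->
    (B `|` C) `*` (B `|` C) #<= C -> False.
  move=> CM CB C_inf /(card_le_relP _ _ _ _)[R [totR injR]].
  have CnB x : C x -> ~ B x by move=> Cx Bx; rewrite -[False]/(set0 x) -CB.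
  pose G' := G `|` [set zy | [/\ ((B `|` C) `*` (B `|` C)) zy.1,
                              ~ (B `*` B) zy.1, C zy.2 & R zy.1 zy.2]].
  have G'tot z : ((B `|` C) `*` (B `|` C)) z ->
      exists2 y, (B `|` C) y & G' (z, y).
    move=> zBC; have [/Gtot[y By Gzy]|nz] := pselect ((B `*` B) z).
      by exists y; left.
    by have [y Cy Rzy] := totR z zBC; exists y; right.
  have domG' : dom G' = B `|` C.
    apply/seteqP; split=> x.
      by move=> [y [Gxy|[[]]]] //; left; exists y.
    by move=> BCx; have [//|y _ ?] := G'tot (x, x); exists y.
  apply: (Gmax G'); first split; last (split; rewrite ?domG' //).
  - by move=> z; left.
  - move=> sub; have [c [_ [Cc _ _]]] := nat_le_two C_inf.
    have [//|y BCy G'y] := G'tot (c, c); first by split; right.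
    by have [[/= /(CnB _ Cc)]] := Gdom _ _ (sub _ G'y).
  - by move=> x [/GM|/CM].
  - right; apply: card_le_trans C_inf _; apply: subset_card_le; exact: subsetUr.
  - move=> z y [Gzy|[? ? ? ?]]; last by split=> //; right.
    by have [[? ?] ?] := Gdom _ _ Gzy; split; [split|]; left.
  - move=> z z' y [Gzy|[zBC nz Cy Rzy]] [Gz'y|[zBC' nz' Cy' Rzy']].
    + exact: Ginj Gzy Gz'y.
    + by have [_ /(CnB _ Cy')] := Gdom _ _ Gzy.
    + by have [_ /(CnB _ Cy)] := Gdom _ _ Gz'y.
    + exact: injR Rzy Rzy'.
have B_inf : [set: nat] #<= B.
  case: G0 => // G0.
  have B0 : B = set0 by rewrite /B G0; apply/seteqP; split=> // x [].
  have [C CM /card_eqPle[CN NC]] := card_le_subset M_inf.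
  exfalso; apply: (ext C CM) => //; first by rewrite B0 setI0.
  rewrite B0 set0U; apply: card_le_trans NC.
  apply: card_le_trans (card_le_setX CN CN) _.
  by rewrite setXTT; have := card_nat2; rewrite card_eq_le => /andP[].
suff MB : M #<= B.
  apply: card_le_trans (card_le_setX MB MB) _.
  by apply: card_le_trans BB _; exact: subset_card_le.
have MBU : M = B `|` (M `\` B).
  apply/seteqP; split=> [x Mx|x [/GM//|[]//]].
  by have [Bx|nBx] := pselect (B x); [left|right].
have [DB|BD] := card_le_total (M `\` B) B.
  by rewrite MBU; apply: card_le_setU_setX.
have [C CD /card_eqPle[CB BC]] := card_le_subset BD.
exfalso; apply: (ext C).
- by move=> x /CD[].
- by apply/seteqP; split=> // x [/CD[]].
- exact: card_le_trans B_inf BC.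
- have UB : B `|` C #<= B by exact: card_le_setU_setX.
  exact: card_le_trans (card_le_setX UB UB) (card_le_trans BB BC).
Qed.

(** * Chains and initial ordinals *)

Lemma card_le_bigcup {I T S : Type} {D : set I} {F : I -> set T} {M : set S} :
  [set: nat] #<= M -> D #<= M -> (forall i, D i -> F i #<= M) ->
  \bigcup_(i in D) F i #<= M.
Proof. by move=> M_inf; apply: card_le_bigcup_setX; exact: card_setX_infinite. Qed.

Lemma card_le_setU {T S : Type} {A B : set T} {M : set S} : [set: nat] #<= M ->
  A #<= M -> B #<= M -> A `|` B #<= M.
Proof. by move=> M_inf; apply: card_le_setU_setX => //; exact: card_setX_infinite. Qed.

(* Split [K] into [K] many copies of itself: either some copy lands in [X], or
   every copy meets [Y]. *)
Lemma card_ge_setU {T S : Type} {K : set S} {X Y : set T} : [set: nat] #<= K ->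
  K #<= X `|` Y -> K #<= X \/ K #<= Y.
Proof.
move=> /card_setX_infinite KK KXY.
have /card_le_relP[R [totR injR]] := card_le_trans KK KXY.
have [[k [Kk inX]]|noX] := pselect (exists k, K k /\ forall k', K k' ->
    exists2 x, X x & R (k, k') x).
  left; apply: (card_le_rel (fun k' x => R (k, k') x)) => // k1 k2 x K1 K2 R1 R2.
  by case: (injR (k, k1) (k, k2) x (conj Kk K1) (conj Kk K2) R1 R2).
right; apply: (card_le_rel (fun k x => exists2 k', K k' & R (k, k') x)).
  move=> k Kk; apply: contrapT => noy; apply: noX; exists k; split=> // k' Kk'.
  have [//|x [Xx|Yx] Rx] := totR (k, k'); first by exists x.
  by exfalso; apply: noy; exists x => //; exists k'.
move=> k1 k2 x K1 K2 [k1' K1' R1] [k2' K2' R2].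
by case: (injR (k1, k1') (k2, k2') x (conj K1 K1') (conj K2 K2') R1 R2).
Qed.

(** Let [Z] be a part of the union of size [K], and choose a member around each of its points. These
    members are cofinal, since a member included in none of them includes them all, hence [Z]. So
    [K] many sets of size at most [K] cover the union. *)
Lemma card_chain_bigcup {I T S : Type} {K : set S} {D : set I} {F : I -> set T} :
  [set: nat] #<= K ->
  (forall i j, D i -> D j -> F i `<=` F j \/ F j `<=` F i) ->
  (forall i, D i -> ~ (K #<= F i)) -> \bigcup_(i in D) F i #<= K.
Proof.
move=> K_inf totF small; have [//|/card_le_subset[Z ZU /card_eqPle[ZK KZ]]] :=
  card_le_total (\bigcup_(i in D) F i) K.
have /choice[r rP] : forall x, exists i, Z x -> D i /\ F i x.
  move=> x; have [/ZU[i Di Fx]|nZ] := pselect (Z x); first by exists i.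
  have [y [_ [Zy _ _]]] := nat_le_two (card_le_trans K_inf KZ).
  by have [i _ _] := ZU y Zy; exists i.
suff sub : \bigcup_(i in D) F i `<=` \bigcup_(x in Z) F (r x).
  apply: card_le_trans (subset_card_le sub) _.
  apply: card_le_bigcup => // x Zx.
  by apply: card_leNle; apply: small; have [] := rP x Zx.
move=> y [j Dj Fy].
have [[x [Zx jx]]|noZ] := pselect (exists x, Z x /\ F j `<=` F (r x)).
  by exists x => //; exact: jx.
exfalso; apply: (small j Dj); apply: card_le_trans KZ _; apply: subset_card_le.
move=> x Zx; have [Dx Fx] := rP x Zx.
by have [xj|jx] := totF _ _ Dx Dj; [exact: xj|exfalso; apply: noZ; exists x].
Qed.

Definition strict_wo {I : Type} (lt : I -> I -> Prop) :=
  [/\ well_founded lt, forall x y z, lt x y -> lt y z -> lt x z &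
      forall x y, [\/ lt x y, x = y | lt y x]].

(** The order axioms come from unique least elements: totality and antisymmetry from pairs,
    transitivity from triples. *)
Lemma strict_wo_exists (T : Type) : exists lt : T -> T -> Prop, strict_wo lt.
Proof.
elim/Peq: T => T; have [R Rwo] := well_ordering_principle T.
have Rmin (A : set T) : A !=set0 -> exists x, A x /\ forall y, A y -> R x y.
  move=> [a Aa]; have [|x [[xA xmin] _]] := Rwo [pred z | `[< A z >]].
    by exists a; apply/asboolP.
  by exists x; split=> [|y Ay]; [exact/asboolP|apply: xmin; exact/asboolP].
have Rtot x y : R x y \/ R y x.
  have [|z [[->|->] zmin]] := Rmin [set z | z = x \/ z = y].
  - by exists x; left.
  - by left; apply: zmin; right.
  - by right; apply: zmin; left.
have Rxx x : R x x by have [] := Rtot x x.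
have Ranti x y : R x y -> R y x -> x = y.
  move=> xy yx; have [|z [_ zuniq]] := Rwo [pred z | `[< z = x \/ z = y >]].
    by exists x; apply/asboolP; left.
  rewrite -(zuniq x) ?(zuniq y) //; split; try (by apply/asboolP; auto).
  - by move=> w /asboolP[]->.
  - by move=> w /asboolP[]->.
have Rtrans x y z : R x y -> R y z -> R x z.
  move=> xy yz; have [|w [wP wmin]] := Rmin [set w | [\/ w = x, w = y | w = z]].
    by exists x; constructor 1.
  have wx : R w x by apply: wmin; constructor 1.
  have wy : R w y by apply: wmin; constructor 2.
  have wz : R w z by apply: wmin; constructor 3.
  case: wP => e; subst w => //; first by rewrite (Ranti _ _ xy wx).
  by rewrite -(Ranti _ _ yz wy).
exists (fun x y => x <> y /\ R x y); split.
- move=> x; apply: contrapT => nacc.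
  have [|m [mN mmin]] := Rmin [set z | ~ Acc (fun x y => x <> y /\ R x y) z].
    by exists x.
  apply: mN; constructor => y [ym Rym]; apply: contrapT => /mmin Rmy.
  by apply: ym; exact: Ranti.
- move=> x y z [xy Rxy] [yz Ryz]; split; last exact: Rtrans Rxy Ryz.
  by move=> xz; subst z; apply: xy; exact: Ranti.
- move=> x y; have [->|/eqP xy] := eqVneq x y; first by constructor 2.
  have [?|?] := Rtot x y; [constructor 1|constructor 3]; split=> //.
  by move=> yx; exact: xy.
Qed.

Lemma strict_wo_irr {I : Type} {lt : I -> I -> Prop} : strict_wo lt ->
  forall x, ~ lt x x.
Proof. by move=> [wf _ _] x; elim/(well_founded_ind wf): x => x IH xx; exact: (IH x). Qed.

Lemma strict_wo_min {I : Type} {lt : I -> I -> Prop} : strict_wo lt ->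
  forall A : set I, A !=set0 -> exists2 x, A x & forall y, lt y x -> ~ A y.
Proof.
move=> [wf _ _] A [a]; elim/(well_founded_ind wf): a => a IH Aa.
have [[y [ya Ay]]|noy] := pselect (exists y, lt y a /\ A y); first exact: IH ya Ay.
by exists a => // y ya Ay; apply: noy; exists y.
Qed.

(** [e] embeds [X] into the shortest initial segment that can hold it, or is the identity if no
    segment below a point can. *)
Lemma initial_ordinal_index (T : Type) (X : set T) :
  exists (lt : T -> T -> Prop) (e : T -> T), [/\ strict_wo lt,
    forall x y, X x -> X y -> e x = e y -> x = y &
    forall x, X x -> ~ (X #<= X `&` [set y | lt (e y) (e x)])].
Proof.
have [lt ltwo] := strict_wo_exists T; exists lt.
have [[z Xz]|noz] := pselect ([set z | X #<= [set w | lt w z]] !=set0).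
  have [|m Xm mmin] := strict_wo_min ltwo [set z | X #<= [set w | lt w z]].
    by exists z.
  have [e [eX einj]] := card_le_fun m Xm; exists e; split=> // x Xx Xle.
  apply: (mmin (e x) (eX x Xx)); apply: card_le_trans Xle _.
  apply: (card_le_rel (fun y w => w = e y)).
    by move=> y [Xy yx]; exists (e y).
  by move=> y y' w [Xy _] [Xy' _] -> /einj->.
exists id; split=> // x Xx Xle; apply: noz; exists x.
by apply: card_le_trans Xle _; apply: subset_card_le => y [].
Qed.

(** * Sorts *)

(** The default [s] stands in for values not below [x]; [Gext] makes it harmless. *)
Lemma wf_fixpoint {T S : Type} {lt : T -> T -> Prop} (G : (T -> S) -> T -> S) (s : S) :
  well_founded lt ->
  (forall f g x, (forall y, lt y x -> f y = g y) -> G f x = G g x) ->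
  exists f, forall x, f x = G f x.
Proof.
move=> wf Gext.
pose F x (f : forall y, lt y x -> S) :=
  G (fun y => if pselect (lt y x) is left yx then f y yx else s) x.
exists (Fix wf (fun=> S) F) => x; rewrite Fix_eq.
  by apply: Gext => y yx; case: pselect.
move=> z f g fg; rewrite /F; congr (G _ z); apply/funext => y.
by case: pselect.
Qed.

Lemma iter_subset {T : Type} {g : set T -> set T} : (forall C, C `<=` g C) ->
  forall C m n, (m <= n)%N -> iter m g C `<=` iter n g C.
Proof.
move=> infl C m n /subnK <-; elim: (n - m)%N => [//|k IH].
by rewrite addSn iterS; exact: subset_trans IH (infl _).
Qed.

(** [U A] is a reservoir from which [H A] is drawn: large enough to survive the loss of kappa
    points, small enough for closing off. *)
Definition admissible (L K : Type) (P : set L) (Y : set (set L)) (U : set L -> set L) :=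
  forall A, Y A -> [/\ U A `<=` A, U A #<= P & ~ (U A #<= [set: K])].

(* [t A] is the sort of colours with which [A] is to be satisfied, at the points
   of [H A]; [p x] is a lower bound imposed on the sort of the point [x]. *)
Definition sorting (L K : Type) (Y : set (set L)) (U : set L -> set L) (p : L -> nat)
    (t : set L -> nat) (H : set L -> set L) :=
  forall A, Y A -> [/\ H A `<=` U A, [set: K] #<= H A,
    forall x, H A x -> (p x <= t A)%N &
    A `&` \bigcup_(B in Y `&` [set B | t B = t A]) H B #<= [set: K]].

(** All [U] and [p] are allowed, since a layer receives reservoirs shrunk by [Z i] and bounds raised
    by earlier sorts. *)
Definition sortable (L K : Type) (P : set L) (Y : set (set L)) :=
  forall U p, admissible L K P Y U -> exists t H, sorting L K Y U p t H.

(* [Z i] contains the points already used by the layers below [i]. A point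
   outside [Z i] lies in at most one set of these layers, so by taking its sort
   larger than the sort of that set, layer [i] does not disturb earlier layers. *)
Lemma sorting_layers (L K I : Type) (P : set L) (lt : I -> I -> Prop)
    (rho : set L -> I) (Z : I -> set L) (Y : set (set L)) (U : set L -> set L)
    (p : L -> nat) :
  [set: nat] #<= [set: K] -> strict_wo lt -> admissible L K P Y U ->
  (forall A, Y A -> A `&` Z (rho A) #<= [set: K]) ->
  (forall B i, Y B -> lt (rho B) i -> U B `<=` Z i) ->
  (forall A B i, Y A -> Y B -> lt (rho A) i -> lt (rho B) i -> A <> B ->
    A `&` B `<=` Z i) ->
  (forall i, sortable L K P (Y `&` [set A | rho A = i])) ->
  exists t H, sorting L K Y U p t H.
Proof.
move=> K_inf lt_wo Uadm meetZ UZ IZ layer.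
pose W i := Y `&` [set A | rho A = i].
have UWadm i : admissible L K P (W i) (fun A => U A `\` Z i).
  move=> A [YA <-]; have [UA UP nUK] := Uadm A YA; split.
  - by move=> x [/UA].
  - by apply: card_le_trans UP; apply: subset_card_le => x [].
  - move=> UZK; apply: nUK; apply: (card_le_trans _ (card_le_setU K_inf UZK (meetZ A YA))).
    apply: subset_card_le => x Ux.
    by have [Zx|nZx] := pselect (Z (rho A) x); [right; split=> //; exact: UA|left].
(* Solutions are fixed for every [q] in advance, as the actual bounds emerge only along the
   recursion. *)
have sol i q : {tH : (set L -> nat) * (set L -> set L) |
    sorting L K (W i) (fun A => U A `\` Z i) q tH.1 tH.2}.
  by apply: cid; have [t [H tHP]] := layer i _ q (UWadm i); exists (t, H).
have /choice[pick pickP] : forall ix : I * L, exists B,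
    (exists B', [/\ Y B', lt (rho B') ix.1 & B' ix.2]) ->
    [/\ Y B, lt (rho B) ix.1 & B ix.2].
  by move=> [i x]; have [[B BP]|noB] := pselect (exists B', [/\ Y B', lt (rho B') i & B' x]);
    [exists B|exists set0].
(* The test excludes default picks and makes [q t i] depend only on sorts of layers below [i]. *)
pose q t i x := if `[< lt (rho (pick (i, x))) i >] then maxn (p x) (t (pick (i, x))).+1
                else p x.
have [lt_wf lt_trans lt_tot] := lt_wo.
have [|t tP] := @wf_fixpoint (set L) nat (fun B A => lt (rho B) (rho A))
  (fun t A => (sval (sol (rho A) (q t (rho A)))).1 A) 0%N
  (wf_inverse_image _ _ _ rho lt_wf).
  move=> f g A fg; suff -> : q f (rho A) = q g (rho A) by [].
  by apply/funext => x; rewrite /q; case: asboolP => // /fg->.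
pose H A := (sval (sol (rho A) (q t (rho A)))).2 A.
have tHP A : Y A -> [/\ H A `<=` U A `\` Z (rho A), [set: K] #<= H A,
    forall x, H A x -> (q t (rho A) x <= t A)%N &
    A `&` \bigcup_(B in W (rho A) `&` [set B | t B = t A]) H B #<= [set: K]].
  move=> YA; have := svalP (sol (rho A) (q t (rho A))) A (conj YA erefl).
  rewrite -tP => -[HU HK Hq Hm]; split=> //.
  apply: card_le_trans Hm; apply: subset_card_le => x [Ax [B [[YB rB] /= tB] HBx]].
  by split=> //; exists B; [split=> //=; rewrite -rB -tP|rewrite -rB].
exists t, H => A YA; have [HU HK Hq Hm] := tHP A YA; split=> //.
- by move=> x /HU[].
- move=> x /Hq; apply: leq_trans; rewrite /q; case: ifP => // _.
  exact: leq_maxl.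
- apply: (card_le_trans _ (card_le_setU K_inf (meetZ A YA) Hm)); apply: subset_card_le.
  move=> x [Ax [B [YB /= tB] HBx]].
  have [HUB _ HqB _] := tHP B YB; have [UBx nZx] := HUB x HBx.
  have [BA|BA|AB] := lt_tot (rho B) (rho A).
  + by left; split=> //; exact: UZ UBx.
  + by right; split=> //; exists B.
  (* A later [B] uses [x] only outside [Z (rho B)], so the picked set is [A] and the sort of [B]
     exceeds that of [A], against [tB]. *)
  + have [|Yp pB px] := pickP (rho B, x); first by exists A.
    have pA : pick (rho B, x) = A.
      by apply: contrapT => pA; apply: nZx; exact: IZ pA _ (conj px Ax).
    have := HqB x HBx; rewrite /q pA asboolT //.
    by rewrite geq_max tB ltnn andbF.
Qed.

(* The sorts are pigeonholed: some bound [n] on [p] holds at [kappa] many points. *)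
Lemma sortable_subsingleton (L K : Type) (P : set L) (Y : set (set L)) :
  [set: nat] #<= [set: K] -> (forall A B, Y A -> Y B -> A = B) ->
  sortable L K P Y.
Proof.
move=> K_inf Y1 U p Uadm.
have [[A YA]|noY] := pselect (Y !=set0); last first.
  by exists (fun=> 0%N), id => A YA; exfalso; apply: noY; exists A.
have [UA _ nUK] := Uadm A YA.
have [n nP] : exists n, ~ (U A `&` [set x | (p x <= n)%N] #<= [set: K]).
  apply/existsNP => small; apply: nUK.
  apply: (@card_le_trans _ _ _ (\bigcup_n (U A `&` [set x | (p x <= n)%N]))).
    by apply: subset_card_le => x Ux; exists (p x) => //; split=> /=.
  by apply: card_le_bigcup => // n _; exact: small.
have [H HU /card_eqPle[HK KH]] := card_le_subset (card_leNle nP).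
exists (fun=> n), (fun=> H) => B YB; rewrite (Y1 B A YB YA); split=> //.
- by move=> x /HU[].
- by move=> x /HU[].
- by apply: card_le_trans HK; apply: subset_card_le => x [_ []].
Qed.

(* [P] stands for the cardinal successor of [K]. *)
Section Sorting.
Variables (L K : Type) (P : set L) (AA : set (set L)).
Hypothesis K_inf : [set: nat] #<= [set: K].
Hypothesis P_gtK : ~ (P #<= [set: K]).
Hypothesis P_min : forall Q : set L, ~ (Q #<= [set: K]) -> P #<= Q.
Hypothesis AA_ad : forall A B, AA A -> AA B -> A <> B -> ~ ([set: K] #<= A `&` B).
Hypothesis AA_count : forall Q : set L, AA `&` [set A | [set: K] #<= A `&` Q] #<= Q.

(** Along an initial ordinal each set has at most kappa predecessors and, by almost disjointness,
    meets each in fewer than kappa points. Layers can thus be single sets. *)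
Lemma sortable_le_succ (Y : set (set L)) : Y `<=` AA -> Y #<= P -> sortable L K P Y.
Proof.
move=> YAA YP U p Uadm; have [lt [e [lt_wo e_inj e_init]]] := initial_ordinal_index _ Y.
pose Z i := \bigcup_(A in Y `&` [set A | lt (e A) i]) A.
apply: (sorting_layers _ _ _ P lt e Z) => //.
- move=> A YA.
  have IK : Y `&` [set B | lt (e B) (e A)] #<= [set: K].
    apply: contrapT => nIK; apply: (e_init A YA).
    have IP : Y `&` [set B | lt (e B) (e A)] #<= P.
      by apply: card_le_trans YP; apply: subset_card_le => x [].
    have [Q QP /card_eqPle[QI IQ]] := card_le_subset IP.
    apply: card_le_trans QI; apply: card_le_trans YP _; apply: P_min => QK.
    by apply: nIK; exact: card_le_trans IQ QK.
  rewrite /Z setI_bigcupr; apply: card_le_bigcup => // B [YB /= BA].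
  apply: card_leNle; apply: AA_ad; try exact: YAA.
  by move=> AB; move: BA; rewrite AB; exact: strict_wo_irr.
- by move=> B i YB Bi x UBx; exists B => //; have [UB _ _] := Uadm B YB; exact: UB.
- by move=> A B i YA YB Ai Bi _ x [Ax _]; exists A.
- move=> i; apply: sortable_subsingleton => // A B [YA Ai] [YB Bi].
  by apply: e_inj => //; rewrite Ai Bi.
Qed.

Lemma succ_infinite : [set: nat] #<= P.
Proof. exact: card_le_trans K_inf (card_leNle P_gtK). Qed.

(** These sets serve as [Z i]. The second clause leaves outside only points in at most one member of
    [C], without including whole members, which could be too large. *)
Definition used_points (U : set L -> set L) (C : set (set L)) : set L :=
  [set x | (exists2 A, C A & U A x) \/
           (exists A B, [/\ C A, C B, A <> B, A x & B x])].

Definition grow (Y : set (set L)) (U : set L -> set L) (C : set (set L)) :=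
  C `|` (Y `&` [set A | [set: K] #<= A `&` used_points U C]).

Lemma used_pointsS U C C' : C `<=` C' -> used_points U C `<=` used_points U C'.
Proof.
move=> CC' x [[A /CC' CA Ux]|[A [B [/CC' CA /CC' CB AB Ax Bx]]]].
  by left; exists A.
by right; exists A, B.
Qed.

Lemma growS Y U C C' : C `<=` C' -> grow Y U C `<=` grow Y U C'.
Proof.
move=> CC' A [/CC'|[YA KA]]; [by left|right; split=> //=].
apply: card_le_trans KA _; apply: subset_card_le; apply: setIS.
exact: used_pointsS.
Qed.

(** The used points come from at most |[M]| reservoirs and pairwise intersections, each of size at
    most |[M]|; [AA_count] then bounds the sets added. *)
Lemma card_le_grow {T : Type} {M : set T} Y U C : Y `<=` AA -> C `<=` Y ->
  admissible L K P Y U -> P #<= M -> C #<= M -> grow Y U C #<= M.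
Proof.
move=> YAA CY Uadm PM CM.
have M_inf := card_le_trans succ_infinite PM.
have KM : [set: K] #<= M := card_le_trans (card_leNle P_gtK) PM.
apply: card_le_setU => //.
apply: (@card_le_trans _ _ _ (used_points U C)).
  apply: card_le_trans (AA_count _); apply: subset_card_le.
  by move=> A [YA KA]; split=> //; exact: YAA.
apply: (@card_le_trans _ _ _ (\bigcup_(A in C) U A `|`
    \bigcup_(AB in (C `*` C) `&` [set AB | AB.1 <> AB.2]) (AB.1 `&` AB.2))).
  apply: subset_card_le => x [[A CA Ux]|[A [B [CA CB AB Ax Bx]]]].
    by left; exists A.
  by right; exists (A, B).
apply: card_le_setU => //; apply: card_le_bigcup => //.
- by move=> A /CY/Uadm[_ UP _]; exact: card_le_trans UP PM.
- apply: (@card_le_trans _ _ _ (C `*` C)); first by apply: subset_card_le => x [].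
  exact: card_le_trans (card_le_setX CM CM) (card_setX_infinite M_inf).
- move=> [A B] [[/= CA CB] AB]; apply: card_le_trans KM; apply: card_leNle.
  by apply: AA_ad => //; apply: YAA; exact: CY.
Qed.

(** Layer [i] consists of the sets first appearing in the closure of the segment up to [i]. It is
    smaller than [Y], so the induction hypothesis applies. *)
Lemma sortable_step (Y : set (set L)) : Y `<=` AA -> ~ (Y #<= P) ->
  (forall W, W `<=` AA -> ~ (Y #<= W) -> sortable L K P W) -> sortable L K P Y.
Proof.
move=> YAA nYP IH U p Uadm.
have Y_inf : [set: nat] #<= Y := card_le_trans succ_infinite (card_leNle nYP).
have [lt [e [lt_wo e_inj e_init]]] := initial_ordinal_index _ Y.
have [lt_wf lt_trans lt_tot] := lt_wo.
(* Index [i] itself is included, so every [A] in [Y] lies in [seg (e A)] and has a rank [rho A]. *)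
pose seg i := Y `&` [set A | ~ lt i (e A)].
pose stage n i := iter n (grow Y U) (seg i).
pose cl i := \bigcup_n stage n i.
have segS i j : lt i j -> seg i `<=` seg j.
  by move=> ij A [YA Ai]; split=> // jA; apply: Ai; exact: lt_trans ij jA.
have stageS n i j : lt i j -> stage n i `<=` stage n j.
  by move=> ij; elim: n => [|n IHn]; [exact: segS|exact: growS].
have stage_le m n i : (m <= n)%N -> stage m i `<=` stage n i.
  by apply: iter_subset => C A; left.
have stageY n i : stage n i `<=` Y.
  by elim: n => [A []//|n IHn A [/IHn//|[]]].
have /choice[rho rhoP] : forall A, exists i, Y A -> cl i A /\ forall j, lt j i -> ~ cl j A.
  move=> A; have [YA|nYA] := pselect (Y A); last by exists (e A).
  have [|i ? ?] := strict_wo_min lt_wo [set i | cl i A]; last by exists i.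
  by exists (e A); exists 0%N => //; split=> //; exact: strict_wo_irr.
pose below i := Y `&` [set A | lt (rho A) i].
apply: (sorting_layers _ _ _ P lt rho (fun i => used_points U (below i))) => //.
- move=> A YA; have [_ Amin] := rhoP A YA; set i := rho A in Amin *.
  pose V n j := A `&` used_points U (stage n j).
  apply: (@card_le_trans _ _ _ (\bigcup_n \bigcup_(j in [set j | lt j i]) V n j)).
    apply: subset_card_le => x [Ax [[B [YB Bi] Ux]|[B [B' [[YB Bi] [YB' Bi'] BB' Bx Bx']]]]].
      have [[n _ Bn] _] := rhoP B YB.
      by exists n => //; exists (rho B) => //; split=> //; left; exists B.
    have [[n _ Bn] _] := rhoP B YB; have [[n' _ Bn'] _] := rhoP B' YB'.
    have [j [ji jB jB']] : exists j, [/\ lt j i, stage (maxn n n') j B & stage (maxn n n') j B'].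
      have {}Bn := stage_le _ _ _ (leq_maxl n n') _ Bn.
      have {}Bn' := stage_le _ _ _ (leq_maxr n n') _ Bn'.
      have [r|r|r] := lt_tot (rho B) (rho B').
      + by exists (rho B'); split=> //; exact: stageS r _ Bn.
      + by exists (rho B'); split=> //; rewrite -r.
      + by exists (rho B); split=> //; exact: stageS r _ Bn'.
    by exists (maxn n n') => //; exists j => //; split=> //; right; exists B, B'.
  (* For fixed [n] the traces [V n j] grow with [j], and each has fewer than kappa points: otherwise
     [A] would enter at stage [n.+1] of [j], below its rank. *)
  apply: card_le_bigcup => // n _; apply: card_chain_bigcup => // [j k _ _|j /= ji KV].
    have [jk|->|kj] := lt_tot j k; [left|by left|right];
      by apply: setIS; apply: used_pointsS; exact: stageS.
  by apply: (Amin j ji); exists n.+1 => //; right.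
- by move=> B i YB Bi x UBx; left; exists B.
- by move=> A B i YA YB Ai Bi AB x [Ax Bx]; right; exists A, B.
- move=> i; apply: IH => [A [/YAA]//|YW].
  have [A [_ [[YA /= Ai] _ _]]] := nat_le_two (card_le_trans Y_inf YW).
  have cl_le T (M : set T) : P #<= M -> seg i #<= M -> Y #<= M.
    move=> PM segM; apply: card_le_trans YW _.
    apply: (@card_le_trans _ _ _ (cl i)).
      by apply: subset_card_le => B [YB /= <-]; have [] := rhoP B YB.
    apply: card_le_bigcup => [||n _]; rewrite ?(card_le_trans succ_infinite PM) //.
    by elim: n => [//|n IHn]; apply: card_le_grow => //; exact: stageY.
  have [Pseg|segP] := card_le_total P (seg i); last exact: nYP (cl_le _ _ _ segP).
  have Yseg := cl_le _ _ Pseg (card_lexx _).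
  (* As [i] need not be a value of [e], it is compared with [e A] for a member [A] of the layer:
     [seg i] consists of predecessors of [A] and possibly [A]. *)
  have [] : Y #<= Y `&` [set B | lt (e B) (e A)] \/ Y #<= [set A].
  + apply: card_ge_setU => //; apply: card_le_trans Yseg _; apply: subset_card_le.
    move=> B [YB iB].
    have iA : ~ lt (e A) i.
      rewrite -Ai => Alt; have [_ /(_ _ Alt)] := rhoP A YA; apply.
      by exists 0%N => //; split=> //; exact: strict_wo_irr.
    have [BA|/e_inj->//|AB] := lt_tot (e B) (e A); [by left|by right|].
    exfalso; have [Ai'|Ai'|iA'] := lt_tot (e A) i; first exact: iA.
      by apply: iB; rewrite -Ai'.
    by apply: iB; exact: lt_trans iA' AB.
  + exact: e_init.
  + move=> Y1; have [B [C [/= -> ->]]] := nat_le_two (card_le_trans Y_inf Y1).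
    by [].
Qed.

(** A counterexample of least size, from [card_min], replaces induction on cardinals. *)
Lemma sortable_all : sortable L K P AA.
Proof.
suff all_ Y : Y `<=` AA -> sortable L K P Y by exact: all_.
move=> YAA; apply: contrapT => nY.
pose bad := {W : set (set L) | W `<=` AA /\ ~ sortable L K P W}.
have [[W [WAA nW]] Wmin] :=
  @card_min bad (fun=> set L) (fun W => sval W) (exist _ Y (conj YAA nY)).
have [WP|nWP] := pselect (W #<= P); first exact/nW/sortable_le_succ.
apply/nW/sortable_step => // V VAA nWV; apply: contrapT => nV.
exact: nWV (Wmin (exist _ V (conj VAA nV))).
Qed.

End Sorting.

(** * Colouring *)

Lemma subsets_lt_small {K T : Type} {B F : set T} :
  subsets_lt K B F -> ~ ([set: K] #<= F).
Proof. by move=> [_ FK /negP nFK] KF; apply: nFK; apply/card_eqPle. Qed.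

Section HereditarilyEssentiallyDisjoint.
Variables (L K : Type) (AA : set (set L)).
Hypothesis K_inf : [set: nat] #<= [set: K].
Hypothesis AA_ge : AA `<=` subsets_ge K [set: L].
Hypothesis AA_hed : hereditarily_essentially_disjoint K [set: L] AA.

(** Selections to feed to [AA_hed], steered into [Q] where possible; [set0] for [Q] leaves them
    free. *)
Lemma hed_select (Q : set L) : exists H : set L -> set L, forall A, AA A ->
  subsets_eq K A (H A) /\ ([set: K] #<= A `&` Q -> H A `<=` Q).
Proof.
suff /choice[H HP] : forall A, exists HA, AA A ->
    subsets_eq K A HA /\ ([set: K] #<= A `&` Q -> HA `<=` Q) by exists H.
move=> A; have [AA_A|nA] := pselect (AA A); last by exists A.
have [KQ|nKQ] := pselect ([set: K] #<= A `&` Q).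
  have [H HAQ HK] := card_le_subset KQ; exists H => _.
  by split=> [|_ x /HAQ[]//]; split=> // x /HAQ[].
have [_ KA] := AA_ge A AA_A.
by have [H HA HK] := card_le_subset KA; exists H.
Qed.

(** Otherwise select [Z] from [A] and [Z] without a point from [B], both of size kappa inside the
    intersection. Dropping the point keeps the selections distinct as sets, so their remainders must
    be disjoint; but two sets of size below kappa cannot cover the smaller selection. *)
Lemma hed_almost_disjoint A B : AA A -> AA B -> A <> B -> ~ ([set: K] #<= A `&` B).
Proof.
move=> AA_A AA_B AB KAB; have [Z ZAB ZK] := card_le_subset KAB.
have /card_eqPle[Z_le KZ] := ZK.
have [z [_ [Zz _ _]]] := nat_le_two (card_le_trans K_inf KZ).
have KZ' : [set: K] #<= Z `\ z.
  have [//|K1] : [set: K] #<= Z `\ z \/ [set: K] #<= [set z].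
    apply: card_ge_setU => //; apply: card_le_trans KZ _; apply: subset_card_le.
    by move=> x Zx; have [->|xz] := pselect (x = z); [right|left].
  by have [a [b [/= -> ->]]] := nat_le_two (card_le_trans K_inf K1).
have Z'K : Z `\ z #= [set: K].
  by apply/card_eqPle; split=> //; apply: card_le_trans Z_le; apply: subset_card_le => x [].
have [H0 H0P] := hed_select set0.
pose H C := if `[< C = A >] then Z else if `[< C = B >] then Z `\ z else H0 C.
have HA : H A = Z by rewrite /H asboolT.
have HB : H B = Z `\ z by rewrite /H asboolF; [rewrite asboolT|exact: nesym].
have [|_ [F [Flt Fdisj]]] := AA_hed H.
  move=> C /H0P[CK _]; rewrite /H; case: asboolP => [->|_].
    by split=> // x /ZAB[].
  by case: asboolP => [->|_//]; split=> // x [/ZAB[]].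
have imZ : (H @` AA) Z by exists A.
have imZ' : (H @` AA) (Z `\ z) by exists B.
have [] : [set: K] #<= F Z \/ [set: K] #<= F (Z `\ z).
  apply: card_ge_setU => //; apply: card_le_trans KZ' _; apply: subset_card_le.
  move=> x Z'x; apply: contrapT => /not_orP[nFZ nFZ'].
  have ZZ' : Z = Z `\ z.
    by apply: Fdisj => //; exists x; split; split=> //; case: Z'x.
  by move: Zz; rewrite ZZ' => -[_]; apply.
- exact: subsets_lt_small (Flt _ imZ).
- exact: subsets_lt_small (Flt _ imZ').
Qed.

(** Reindexing by [A] is possible because equal selections from distinct members would contradict
    almost disjointness. *)
Lemma hed_remainders (H : set L -> set L) : (forall A, AA A -> subsets_eq K A (H A)) ->
  exists F : set L -> set L,
    (forall A, AA A -> ~ ([set: K] #<= F A)) /\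
    (forall A B x, AA A -> AA B -> (H A `\` F A) x -> (H B `\` F B) x -> A = B).
Proof.
move=> HP; have [_ [F [Flt Fdisj]]] := AA_hed H HP; exists (F \o H); split.
  by move=> A AA_A; apply: (@subsets_lt_small _ _ (H A)); apply: Flt; exists A.
move=> A B x AA_A AA_B HAx HBx; apply: contrapT => AB.
have HAB : H A = H B.
  by apply: Fdisj; [exists A|exists B|exists x].
apply: (hed_almost_disjoint A B) => //.
have [HA /card_eqPle[_ KH]] := HP A AA_A; have [HB _] := HP B AA_B.
apply: card_le_trans KH _; apply: subset_card_le => y Hy; split; first exact: HA.
by apply: HB; rewrite -HAB.
Qed.

(** Selections inside [Q] have nonempty disjoint remainders, so each such member claims its own
    point of [Q]. *)
Lemma hed_count (Q : set L) : AA `&` [set A | [set: K] #<= A `&` Q] #<= Q.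
Proof.
have [H HP] := hed_select Q.
have [|F [Fsmall Fdisj]] := hed_remainders H; first by move=> A /HP[].
apply: (card_le_rel (fun A x => (H A `\` F A) x)).
  move=> A [AA_A KA]; have [[_ /card_eqPle[_ KH]] HQ] := HP A AA_A.
  apply: contrapT => noQ; apply: (Fsmall A AA_A); apply: card_le_trans KH _.
  apply: subset_card_le => x Hx; apply: contrapT => nFx; apply: noQ.
  by exists x; [exact: HQ|].
by move=> A B x [AA_A _] [AA_B _]; exact: Fdisj.
Qed.

Lemma hed_sorting : exists (t : set L -> nat) (H : set L -> set L),
  sorting L K (AA `&` [set A | ~ (A #<= [set: K])]) id (fun=> 0%N) t H.
Proof.
set BB := AA `&` _.
(* A member larger than kappa guarantees that [L] has a subset [P] whose size is the successor of
   kappa. *)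
have [[A0 [_ A0_gt]]|noBB] := pselect (BB !=set0); last first.
  by exists (fun=> 0%N), id => A BB_A; exfalso; apply: noBB; exists A.
pose large := {Q : set L | ~ (Q #<= [set: K])}.
have [[P P_gt] /= Pmin] := @card_min large (fun=> L) (fun Q => sval Q) (exist _ A0 A0_gt).
have {}Pmin (Q : set L) : ~ (Q #<= [set: K]) -> P #<= Q.
  by move=> Q_gt; exact: Pmin (exist _ Q Q_gt).
have /choice[U UP] : forall A, exists U, BB A -> U `<=` A /\ U #= P.
  move=> A; have [[AA_A A_gt]|nA] := pselect (BB A); last by exists A.
  by have [U ? ?] := card_le_subset (Pmin A A_gt); exists U.
have [||||||t [H tH]] := sortable_all L K P BB _ _ _ _ _ U (fun=> 0%N) => //.
- by move=> A B [? _] [? _]; exact: hed_almost_disjoint.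
- move=> Q; apply: card_le_trans (hed_count Q); apply: subset_card_le.
  by move=> A [[? _] ?].
- move=> A /UP[UA /card_eqPle[U_le PU]]; split=> // UK.
  exact: P_gt (card_le_trans PU UK).
exists t, H => A BB_A; have [HU KH _ Hm] := tH A BB_A; split=> //.
by apply: subset_trans HU _; have [] := UP A BB_A.
Qed.

End HereditarilyEssentiallyDisjoint.

Theorem theorem4p1 (L K : Type)
    (omega_le_kappa : [set: nat] #<= [set: K])
    (kappa_le_lambda : [set: K] #<= [set: L])
    (AA : set (set L))
    (AA_ge : AA `<=` subsets_ge K [set: L])
    (AA_hed : hereditarily_essentially_disjoint K [set: L] AA) :
  exists c : L -> K,
    forall A : set L, AA A -> unique_values c A #= [set: K].
Proof.
have [t [H tH]] := hed_sorting L K AA omega_le_kappa AA_ge AA_hed.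
pose small (A : set L) := `[< A #<= [set: K] >].
(* Sort 0 is reserved for members of size kappa, hence the shift for the others. *)
pose sort A := if small A then 0 else (t A).+1.
pose D n := \bigcup_(B in (AA `&` [set A | ~ (A #<= [set: K])]) `&` [set B | t B = n]) H B.
(* Taking the trace on [D (t A)] rather than [H A] puts every point of a large [A] whose colour has
   the sort of [A] under the control of [g A]. *)
pose M A := if small A then A else A `&` D (t A).
have MP A : AA A -> subsets_eq K A (M A).
  move=> AA_A; rewrite /M /small; case: asboolP => [AK|nAK].
    by split=> //; apply/card_eqPle; split=> //; have [] := AA_ge A AA_A.
  have [HA KH _ DK] := tH A (conj AA_A nAK).
  split; first by move=> x [].
  apply/card_eqPle; split=> //; apply: card_le_trans KH _; apply: subset_card_le.
  by move=> x Hx; split; [exact: HA|exists A].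
have [F [Fsmall Fdisj]] := hed_remainders L K AA omega_le_kappa AA_ge AA_hed M MP.
have [k0 _] := nat_le_two omega_le_kappa.
have [code [_ code_inj]] := card_le_fun k0 (card_le_trans
  (card_le_setX omega_le_kappa (card_lexx [set: K])) (card_setX_infinite omega_le_kappa)).
have {}code_inj x y : code x = code y -> x = y by exact: code_inj.
have /choice[g g_inj] : forall A, exists g : L -> K, AA A ->
    forall x y, M A x -> M A y -> g x = g y -> x = y.
  move=> A; have [/MP[_ /card_eqPle[MK _]]|nA] := pselect (AA A); last by exists (fun=> k0).
  by have [g [_ g_inj]] := card_le_fun k0 MK; exists g.
pose G A := M A `\` F A.
(* Points in no remainder get a colour of sort 0, which cannot collide with the positive sorts of
   larger members. *)
have /choice[c cP] : forall x, exists k,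
    (exists A, [/\ AA A, G A x & k = code (sort A, g A x)]) \/
    (forall A, AA A -> ~ G A x) /\ k = code (0, k0).
  move=> x; have [[A [AA_A Gx]]|noG] := pselect (exists A, AA A /\ G A x).
    by exists (code (sort A, g A x)); left; exists A.
  by exists (code (0, k0)); right; split=> // A AA_A Gx; apply: noG; exists A.
have cG A x : AA A -> G A x -> c x = code (sort A, g A x).
  move=> AA_A Gx; have [[B [AA_B GBx ->]]|[noG _]] := cP x; last by have := noG A AA_A.
  by rewrite (Fdisj A B x).
have sort_M A y k : AA A -> A y -> c y = code (sort A, k) -> M A y.
  move=> AA_A Ay; have [[B [AA_B [MBy _] ->]]|[_ ->]] := cP y => /code_inj[].
    rewrite /sort /M; case: ifP => [_|smB]; case: ifP => [_|smA] // [tBA] _.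
    by split=> //; move: MBy; rewrite /M smB tBA => -[].
  by rewrite /sort /M; case: ifP.
exists c => A AA_A; have [MA /card_eqPle[_ KM]] := MP A AA_A.
apply/card_eqPle; split; first exact: card_leT.
have KG : [set: K] #<= G A.
  have [//|KF] : [set: K] #<= G A \/ [set: K] #<= F A.
    apply: card_ge_setU => //; apply: card_le_trans KM _; apply: subset_card_le => x Mx.
    by have [Fx|nFx] := pselect (F A x); [right|left].
  by exfalso; exact: Fsmall KF.
have c_inj x y : G A x -> G A y -> c x = c y -> x = y.
  move=> Gx Gy; rewrite (cG A x) ?(cG A y) // => /code_inj[gxy].
  by apply: (g_inj A) => //; [case: Gx|case: Gy].
have KcG : [set: K] #<= c @` G A.
  apply: card_le_trans KG _; apply: (card_le_rel (fun x k => k = c x)).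
    by move=> x Gx; exists (c x) => //; exists x.
  by move=> x x' k Gx Gx' -> /c_inj->.
(* A colour of [G A] absent from [F A] occurs once on [A]: by [sort_M] any point of [A] bearing it
   lies in [G A], where [c] is injective. As [F A] has fewer than kappa points, kappa such colours
   remain. *)
have [//|KcF] : [set: K] #<= unique_values c A \/ [set: K] #<= c @` F A.
  apply: card_ge_setU => //; apply: card_le_trans KcG _; apply: subset_card_le.
  move=> _ [x Gx <-]; have [cF|ncF] := pselect ((c @` F A) (c x)); [by right|left].
  split; first by exists x.
  suff -> : A `&` c @^-1` [set c x] = [set x] by exact: card_set1.
  apply/seteqP; split=> [y [Ay /= cyx]|_ ->]; last by split=> //; apply: MA; case: Gx.
  apply: c_inj => //; split; last by move=> Fy; apply: ncF; exists y.
  by apply: (sort_M A y (g A x)) => //; rewrite cyx; exact: cG.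
by exfalso; apply: (Fsmall A AA_A); exact: card_le_trans KcF (card_image_le _ _).
Qed.
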